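(* Let $X$ be a real Banach space with the Daugavet property and let $T$ be an operator on $X$ which does not fix a copy of $\ell_1$. Then $T\in\mathrm{cp}(\mathcal{NAR}(X))$, where $\mathrm{cp}(\mathcal{NAR}(X))$ is the central part of the class $\mathcal{NAR}(X)$ of narrow operators on $X$; in particular, $T$ is a narrow operator.
   Context: All Banach spaces are real; $S(X)$ is the unit sphere of $X$. An operator on $X$ is a bounded linear operator from $X$ into some Banach space (depending on the operator). $X$ has the Daugavet property if $\|\mathrm{Id}+R\|=1+\|R\|$ for every rank-one operator $R\colon X\to X$. An operator $T$ on $X$ does not fix a copy of $\ell_1$ if there is no subspace $E\subset X$ isomorphic to $\ell_1$ such that the restriction $T\colon E\to T(E)$ is an isomorphism. Operators $T_1,T_2$ on $X$ are equivalent if $\|T_1x\|=\|T_2x\|$ for all $x\in X$; $\mathcal{OP}(X)$ is the set of all operators on $X$ with equivalent ones identified (equivalently, the set of seminorms $x\mapsto\|Tx\|$). For $T_1\colon X\to Y_1$, $T_2\colon X\to Y_2$ define $T_1\mathbin{\tilde+}T_2\colon X\to Y_1\oplus_1Y_2$, $x\mapsto(T_1x,T_2x)$, so $\|(T_1\mathbin{\tilde+}T_2)x\|=\|T_1x\|+\|T_2x\|$. This is a commutative associative operation on $\mathcal{OP}(X)$; a subsemigroup is a subset of $\mathcal{OP}(X)$ closed under $\tilde+$. $T$ is a strong Daugavet operator if for all $x,y\in S(X)$ and $\varepsilon>0$ there is $z\in S(X)$ with $\|T(z-y)\|<\varepsilon$ and $\|z+x\|>2-\varepsilon$. $T$ is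 narrow if $T\mathbin{\tilde+}x^*$ is a strong Daugavet operator for every $x^*\in X^*$; $\mathcal{NAR}(X)\subset\mathcal{OP}(X)$ is the class of narrow operators. For $\mathcal M\subset\mathcal{OP}(X)$, a subsemigroup $\mathcal M_1\subset\mathcal M$ of $\mathcal{OP}(X)$ is a maximal subsemigroup of $\mathcal M$ if every subsemigroup $\mathcal M_2\subset\mathcal M$ including $\mathcal M_1$ coincides with $\mathcal M_1$. The central part $\mathrm{cp}(\mathcal M)$ is the intersection of all maximal subsemigroups of $\mathcal M$. *)

(* Defs.v *)
From HB Require Import structures.
From mathcomp Require Import all_boot all_order all_algebra.
From mathcomp Require Import all_classical all_reals all_analysis.

Set Implicit Arguments.
Unset Strict Implicit.
Unset Printing Implicit Defensive.

Import Order.TTheory GRing.Theory Num.Theory.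
Import numFieldNormedType.Exports.

Local Open Scope classical_set_scope.
Local Open Scope ring_scope.

Section Ell1.
Variable R : realType.

Definition abs_series (u : nat -> R) : R^nat := [series `|u n|]_n.

Definition abs_summable : {pred (nat -> R)} :=
  [pred u : nat -> R | `[< cvgn (abs_series u) >]].

Lemma abs_summableP (u : nat -> R) :
  reflect (cvgn (abs_series u)) (u \in abs_summable).
Proof. exact: asboolP. Qed.

Lemma abs_seriesE (u : nat -> R) n : abs_series u n = \sum_(0 <= k < n) `|u k|.
Proof. by []. Qed.

Lemma cvg_abs_seriesZ (a : R) (u : nat -> R) : cvgn (abs_series u) ->
  abs_series (a *: u) @ \oo --> `|a| * limn (abs_series u).
Proof.
move=> cu.
have -> : abs_series (a *: u) = (fun n => `|a| * abs_series u n).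
  apply/funext => n; rewrite !abs_seriesE mulr_sumr.
  by apply: eq_bigr => i _; rewrite -normrM.
exact: cvgMl_tmp.
Qed.

Lemma cvg_abs_seriesD (u v : nat -> R) : cvgn (abs_series u) ->
  cvgn (abs_series v) -> cvgn (abs_series (u + v)).
Proof.
move=> cu cv; apply: (@series_le_cvg _ _ (fun n => `|u n| + `|v n|)).
- by move=> n; rewrite normr_ge0.
- by move=> n; rewrite addr_ge0 ?normr_ge0.
- by move=> n; exact: ler_normD.
- rewrite [X in cvgn X](_ : _ = abs_series u + abs_series v).
    exact: is_cvgD.
  by apply/funext => n; exact: big_split.
Qed.

Lemma abs_summable_submod : submod_closed abs_summable.
Proof.
split.
  apply/abs_summableP; rewrite (_ : abs_series _ = cst 0).
    exact: is_cvg_cst.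
  by apply/funext => n; rewrite abs_seriesE big1 // => i _; rewrite normr0.
move=> a u v /abs_summableP cu /abs_summableP cv; apply/abs_summableP.
apply: cvg_abs_seriesD => //; apply/cvg_ex; eexists; exact: cvg_abs_seriesZ.
Qed.

HB.instance Definition _ :=
  GRing.isSubmodClosed.Build R (nat -> R) abs_summable abs_summable_submod.

Record ell1 := Ell1 { ell1_val :> nat -> R; _ : ell1_val \in abs_summable }.

HB.instance Definition _ := [isSub for ell1_val].
HB.instance Definition _ := [Choice of ell1 by <:].
HB.instance Definition _ := [SubChoice_isSubLmodule of ell1 by <:].

Definition ell1_norm (u : ell1) : R := limn (abs_series u).

Lemma ell1_cvg (u : ell1) : cvgn (abs_series u).
Proof. exact/abs_summableP/(valP u). Qed.

Lemma ell1_normD (u v : ell1) : ell1_norm (u + v) <= ell1_norm u + ell1_norm v.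
Proof.
rewrite /ell1_norm -limD; [|exact: ell1_cvg|exact: ell1_cvg].
apply: ler_lim; [exact: ell1_cvg|apply: is_cvgD; exact: ell1_cvg|].
apply: nearW => n; rewrite fctE !abs_seriesE /= -big_split /=.
by apply: ler_sum => i _; exact: ler_normD.
Qed.

Lemma ell1_normZ (a : R) (u : ell1) : ell1_norm (a *: u) = `|a| * ell1_norm u.
Proof. exact/cvg_lim/cvg_abs_seriesZ/ell1_cvg. Qed.

Lemma ell1_norm0_eq0 (u : ell1) : ell1_norm u = 0 -> u = 0.
Proof.
move=> u0; apply/val_inj/funext => n /=; apply/normr0_eq0/le_anti.
rewrite normr_ge0 andbT.
have nd : nondecreasing_seq (abs_series u).
  apply/nondecreasing_seqP => k.
  by rewrite !abs_seriesE big_nat_recr//= lerDl.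
have := nondecreasing_cvgn_le nd (@ell1_cvg u) n.+1.
rewrite -/(ell1_norm u) u0; apply: le_trans.
by rewrite abs_seriesE big_nat_recr//= lerDr sumr_ge0.
Qed.

HB.instance Definition _ :=
  Lmodule_isNormed.Build R ell1 ell1_normD ell1_normZ ell1_norm0_eq0.

End Ell1.

(* The space Y1 (+)_1 Y2, as a copy of Y1 * Y2, on which the library already
   puts the maximum norm. *)
Definition sum1 (Y1 Y2 : Type) : Type := (Y1 * Y2)%type.

Section Sum1.
Variables (R : realType) (Y1 Y2 : completeNormedModType R).

HB.instance Definition _ := GRing.Lmodule.copy (sum1 Y1 Y2) (Y1 * Y2)%type.

Definition sum1_norm (y : sum1 Y1 Y2) : R := `|y.1| + `|y.2|.

Lemma sum1_normD (y z : sum1 Y1 Y2) :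
  sum1_norm (y + z) <= sum1_norm y + sum1_norm z.
Proof. by rewrite /sum1_norm addrACA lerD // ler_normD. Qed.

Lemma sum1_normZ (a : R) (y : sum1 Y1 Y2) :
  sum1_norm (a *: y) = `|a| * sum1_norm y.
Proof. by rewrite /sum1_norm /= !normrZ mulrDr. Qed.

Lemma sum1_norm0_eq0 (y : sum1 Y1 Y2) : sum1_norm y = 0 -> y = 0.
Proof.
case: y => y1 y2 /eqP; rewrite /sum1_norm paddr_eq0 //= !normr_eq0.
by case/andP=> /eqP -> /eqP ->.
Qed.

HB.instance Definition _ :=
  Lmodule_isNormed.Build R (sum1 Y1 Y2) sum1_normD sum1_normZ sum1_norm0_eq0.

Lemma sum1_normE (y : sum1 Y1 Y2) : `|y| = `|y.1| + `|y.2|.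
Proof. by []. Qed.

Lemma sum1_complete (F : set_system (sum1 Y1 Y2)) :
  ProperFilter F -> cauchy F -> cvg F.
Proof.
move=> FF /cauchyP Fc.
have dist_lt (e : R) (y z : sum1 Y1 Y2) : ball y e z ->
    `|y.1 - z.1| < e /\ `|y.2 - z.2| < e.
  rewrite -ball_normE /= sum1_normE /= => yz.
  by split; apply: le_lt_trans yz; rewrite ?lerDl ?lerDr.
pose p1 : sum1 Y1 Y2 -> Y1 := fst; pose p2 : sum1 Y1 Y2 -> Y2 := snd.
have /cvg_ex[l1 cl1] : cvg (p1 @ F).
  apply: cauchy_cvg; apply/cauchyP => e e0; have [y Fy] := Fc e e0; exists y.1.
  suff : F (p1 @^-1` ball y.1 e) by [].
  apply: filterS Fy => z /dist_lt[yz _].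
  by rewrite /preimage/= -ball_normE.
have /cvg_ex[l2 cl2] : cvg (p2 @ F).
  apply: cauchy_cvg; apply/cauchyP => e e0; have [y Fy] := Fc e e0; exists y.2.
  suff : F (p2 @^-1` ball y.2 e) by [].
  apply: filterS Fy => z /dist_lt[_ yz].
  by rewrite /preimage/= -ball_normE.
apply/cvg_ex; exists ((l1, l2) : sum1 Y1 Y2).
apply/cvgrPdist_lt => e e0; near=> z.
rewrite sum1_normE /= [e]splitr ltrD //.
  by near: z; move/cvgrPdist_lt: cl1; apply; rewrite divr_gt0.
by near: z; move/cvgrPdist_lt: cl2; apply; rewrite divr_gt0.
Unshelve. all: by end_near. Qed.

HB.instance Definition _ := Uniform_isComplete.Build (sum1 Y1 Y2) sum1_complete.

End Sum1.

Section Operators.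
Variable R : realType.

Definition bounded_operator (X Y : normedModType R) (T : X -> Y) : Prop :=
  exists M : R, forall x, `|T x| <= M * `|x|.

Definition unit_sphere (X : normedModType R) : set X := [set x | `|x| = 1].

(* Meaningful for bounded T; sup is 0 on unbounded sets. *)
Definition opnorm (X Y : normedModType R) (T : X -> Y) : R :=
  sup [set `|T x| | x in [set x | `|x| <= 1]].

Definition rank_one (X Y : normedModType R) (T : X -> Y) : Prop :=
  exists2 y : Y, y != 0 & range T = range (fun a : R => a *: y).

Definition daugavet_property (X : normedModType R) : Prop :=
  forall S : {linear X -> X}, bounded_operator S -> rank_one S ->
    opnorm (fun x => x + S x) = 1 + opnorm S.

(* f restricted to E is a homeomorphism from E onto f(E); for a linear f the
   inverse g is automatically linear on f(E). *)
Definition isomorphism_on (X Y : normedModType R) (E : set X) (f : X -> Y) :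
    Prop :=
  {within E, continuous f} /\
  exists g : Y -> X,
    (forall x, E x -> g (f x) = x) /\ {within f @` E, continuous g}.

(* No linearity of E is required: as the range of a linear map, E is a
   subspace, and it is closed when X is complete. *)
Definition isomorphic_to_ell1 (X : normedModType R) (E : set X) : Prop :=
  exists J : {linear ell1 R -> X}, isomorphism_on setT J /\ range J = E.

Definition fixes_copy_of_ell1 (X Y : normedModType R) (T : X -> Y) : Prop :=
  exists E : set X, isomorphic_to_ell1 E /\ isomorphism_on E T.

Definition strong_daugavet (X Y : normedModType R) (T : X -> Y) : Prop :=
  forall (x y : X) (e : R), unit_sphere x -> unit_sphere y -> 0 < e ->
    exists z : X, [/\ unit_sphere z, `|T (z - y)| < e & `|z + x| > 2 - e].

End Operators.

Section TildeSum.
Variables (R : realType) (X Y1 Y2 : completeNormedModType R).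
Variables (T1 : {linear X -> Y1}) (T2 : {linear X -> Y2}).

Definition tilde_sum (x : X) : sum1 Y1 Y2 := (T1 x, T2 x).

Lemma tilde_sum_is_linear : linear tilde_sum.
Proof. by move=> a x y; rewrite /tilde_sum !linearP. Qed.

HB.instance Definition _ :=
  GRing.isLinear.Build R X (sum1 Y1 Y2) _ tilde_sum tilde_sum_is_linear.

End TildeSum.

Section OP.
Variables (R : realType) (X : completeNormedModType R).

Definition narrow (Y : completeNormedModType R) (T : {linear X -> Y}) : Prop :=
  forall f : {linear X -> R^o}, bounded_operator f ->
    strong_daugavet (tilde_sum T f).

(* Two operators are equivalent iff their classes are the same function, so
   OP(X) is represented as the set of these seminorms. *)
Definition op_class (Y : completeNormedModType R) (T : {linear X -> Y}) :
  X -> R := fun x => `|T x|.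

Lemma op_class_tilde_sum (Y1 Y2 : completeNormedModType R)
    (T1 : {linear X -> Y1}) (T2 : {linear X -> Y2}) :
  op_class (tilde_sum T1 T2) = op_class T1 + op_class T2.
Proof. by []. Qed.

Definition OP : set (X -> R) :=
  [set p | exists (Y : completeNormedModType R) (T : {linear X -> Y}),
     bounded_operator T /\ p = op_class T].

Definition NAR : set (X -> R) :=
  [set p | exists (Y : completeNormedModType R) (T : {linear X -> Y}),
     [/\ bounded_operator T, narrow T & p = op_class T]].

Definition subsemigroup (M : set (X -> R)) : Prop :=
  M `<=` OP /\
  forall (Y1 Y2 : completeNormedModType R)
    (T1 : {linear X -> Y1}) (T2 : {linear X -> Y2}),
    bounded_operator T1 -> bounded_operator T2 ->
    M (op_class T1) -> M (op_class T2) -> M (op_class (tilde_sum T1 T2)).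

Definition maximal_subsemigroup (M M1 : set (X -> R)) : Prop :=
  [/\ subsemigroup M1, M1 `<=` M &
     forall M2, subsemigroup M2 -> M2 `<=` M -> M1 `<=` M2 -> M2 = M1].

Definition central_part (M : set (X -> R)) : set (X -> R) :=
  \bigcap_(M1 in maximal_subsemigroup M) M1.

End OP.

Arguments OP {R} X.
Arguments NAR {R} X.

(* Main.v *)
Require Import Defs.
From HB Require Import structures.
From mathcomp Require Import all_boot all_order all_algebra.
From mathcomp Require Import all_classical all_reals all_analysis.
From mathcomp Require Import ring lra.
Import numFieldNormedType.Exports.

(** Why the theorem holds.  Narrowness only involves the seminorm
    [q = op_class T], so everything is said about seminorms [q] on [X].  Call
    [q] a Daugavet seminorm when every unit vector [y] can be [q]-approximated
    by unit vectors [z] that are almost orthogonal, in the sense of the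
    1-norm, to a prescribed vector [v]: [`|v + z|] is almost [`|v| + 1].  For
    [q = op_class T] this says that [T] is a strong Daugavet operator, and [q]
    is narrow when [q + `|f|] is a Daugavet seminorm for every bounded
    functional [f].

    The heart of the matter is that if [q] is narrow and [T] does not fix a
    copy of l1, then [q + `|T|] is again narrow
    (narrow_seminorm_not_fixing_ell1).  Suppose that no [z] approximating [y]
    for [q] and almost orthogonal to [v] satisfies [`|T (z - y)| < e].  Choose
    vectors [b] one after the other, each close to [y] for [q] and almost
    orthogonal to the sum of [v] and the previous ones.  Every convex
    combination [z] of such a family is still close to [y] for [q] and almost
    orthogonal to [v], so [`|T (z - y)| >= e], and by Hahn-Banach one
    functional [t] of the dual ball has [t (T (b - y)) >= e] on the whole
    family.  On the other hand [q] is narrow, so [b] can be taken with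
    [T (b - y)] small on any given finite set of functionals.  Playing the two
    facts against each other (persistent_split) gives a sequence [a] such that
    for every choice of finitely many signs there is a functional [t] of the
    dual ball with [t (T (a k - y)) >= e] where the sign is plus and [<= e / 2]
    where it is minus.  By Rosenthal's inequality (separated_ell1_lower_bound) the vectors
    [T (a k - y)] are then equivalent to the unit vector basis of l1, so [T]
    fixes a copy of l1.  Compactness enters through finite powers of the dual
    ball (dual_ball_compactness).

    Three facts complete the argument.  A narrow seminorm tolerates finitely
    many functionals and not just one (narrow_seminorm_family).  The zero
    seminorm is narrow when [X] has the Daugavet property
    (daugavet_narrow_seminorm0), so [T] itself is narrow.  Finally, if [M] is
    a maximal subsemigroup of the narrow operators, adjoining to it all
    [p + n T] keeps it a subsemigroup of narrow operators, so [T] was in [M]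
    from the start. *)

Set Implicit Arguments.
Unset Strict Implicit.
Unset Printing Implicit Defensive.

Import Order.TTheory GRing.Theory Num.Theory.

Local Open Scope classical_set_scope.
Local Open Scope ring_scope.

(** * Sublinear functionals and the Hahn-Banach theorem *)

Section Sublinear.
Variables (R : realType) (V : lmodType R).
Implicit Types (p q : V -> R) (u v w : V).

(** For scalars only an inequality is asked, because it is the one that passes
    to infima; the equality follows by scaling back ([sublinearZ]). *)
Definition sublinear p :=
  (forall u v, p (u + v) <= p u + p v) /\
  (forall a u, 0 < a -> p (a *: u) <= a * p u).

Lemma sublinear0 p : sublinear p -> p 0 = 0.
Proof.
move=> [_ pZ]; have := pZ 2 0 ltac:(lra); have := pZ 2^-1 0 ltac:(lra).
rewrite !scaler0; lra.
Qed.

Lemma sublinearZ p a u : sublinear p -> 0 <= a -> p (a *: u) = a * p u.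
Proof.
move=> sp; rewrite le0r => /predU1P[->|a0].
  by rewrite scale0r sublinear0// mul0r.
apply/le_anti; rewrite sp.2//= -ler_pdivlMl//.
by rewrite -{1}[u]scale1r -(mulVf (lt0r_neq0 a0)) -scalerA sp.2// invr_gt0.
Qed.

Lemma sublinearN p u : sublinear p -> - p (- u) <= p u.
Proof. by move=> sp; have := sp.1 u (- u); rewrite subrr sublinear0//; lra. Qed.

(** The hypotheses on [F] say that infima over [D] inherit subadditivity and
    homogeneity; they cover both the infimum of a chain and the infimal
    convolution with a convex cone. *)
Lemma sublinear_inf (I : Type) (D : set I) (F : I -> V -> R) (l : V -> R) :
  D !=set0 -> (forall i u, D i -> l u <= F i u) ->
  (forall i j u v, D i -> D j ->
     exists2 k, D k & F k (u + v) <= F i u + F j v) ->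
  (forall i a u, D i -> 0 < a -> exists2 k, D k & F k (a *: u) <= a * F i u) ->
  let p u := inf [set F i u | i in D] in
  sublinear p /\ (forall i u, D i -> p u <= F i u).
Proof.
move=> [i0 Di0] lF FD FZ p.
have lb u : has_lbound [set F i u | i in D].
  by exists (l u) => _ [i Di <-]; exact: lF.
have pF i u : D i -> p u <= F i u by move=> Di; apply: ge_inf => //; exists i.
have Fp u e : 0 < e -> exists2 i, D i & F i u < p u + e.
  move=> e0; have [|_ [i Di <-] iu] := @inf_adherent _ [set F i u | i in D] e
    e0.
    by split => //; exists (F i0 u), i0.
  by exists i.
split => //; split.
  move=> u v; apply/ler_addgt0Pr => e e0.
  have [i Di iu] := Fp u (e / 2) ltac:(lra).
  have [j Dj jv] := Fp v (e / 2) ltac:(lra).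
  have [k Dk kuv] := FD i j u v Di Dj.
  by have := pF k (u + v) Dk; lra.
move=> a u a0; rewrite -ler_pdivrMl//; apply/ler_addgt0Pr => e e0.
have [i Di iu] := Fp u e e0; have [k Dk kau] := FZ i a u Di a0.
by rewrite ler_pdivrMl// (le_trans (pF k _ Dk))// (le_trans kau)// ler_pM2l//
  ltW.
Qed.

Definition convex_cone (P : set (V * R)) :=
  [/\ P !=set0,
      forall c d, P c -> P d -> P (c.1 + d.1, c.2 + d.2) &
      forall a c, 0 < a -> P c -> P (a *: c.1, a * c.2)].

(** If [p] dominates the prices [c.2] of the vectors [c.1] in a convex cone,
    then paying the cheapest way, [q u = inf (p (u + c.1) - c.2)], is still
    sublinear.  A linear functional below [q] is below [p] and is at least
    [c.2] at each [c.1]. *)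
Lemma sublinear_shift p (P : set (V * R)) :
  sublinear p -> convex_cone P -> (forall c, P c -> c.2 <= p c.1) ->
  exists q, [/\ sublinear q, forall c u, P c -> q u <= p (u + c.1) - c.2 &
                forall c, P c -> q (- c.1) <= - c.2].
Proof.
move=> sp [P0 PD PZ] Pp.
have [|||sq qF] := @sublinear_inf _ P (fun c u => p (u + c.1) - c.2)
    (fun u => - p (- u)) P0.
- move=> c u Pc; have := sp.1 (u + c.1) (- u).
  by rewrite addrAC subrr add0r; have := Pp _ Pc; lra.
- move=> c d u v Pc Pd; exists (c.1 + d.1, c.2 + d.2); first exact: PD.
  by rewrite /= addrACA; have := sp.1 (u + c.1) (v + d.1); lra.
- move=> c a u Pc a0; exists (a *: c.1, a * c.2); first exact: PZ.
  by rewrite /= -scalerDr mulrBr lerD2r sp.2.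
eexists; split; [exact: sq | by move=> c u; exact: qF|].
by move=> c Pc; apply: le_trans (qF c _ Pc) _; rewrite addNr sublinear0// sub0r.
Qed.

(** Shifting a minimal [q] along a ray [s w] at price [s q w] gives a sublinear
    minorant, hence [q] itself, and this says [q u + q w <= q (u + w)]. *)
Lemma minimal_sublinear_additive q :
  sublinear q ->
  (forall r, sublinear r -> (forall u, r u <= q u) -> r = q) ->
  forall u w, q (u + w) = q u + q w.
Proof.
move=> sq qmin u w; apply/le_anti; rewrite sq.1/=.
have [||r [sr rq rw]] :=
    @sublinear_shift q [set c | exists2 s : R, 0 <= s & c = (s *: w, s * q w)]
      sq.
- split; first by exists (0 *: w, 0 * q w), 0.
    move=> _ _ [s s0 ->] [t t0 ->]; exists (s + t); first exact: addr_ge0.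
    by rewrite scalerDl mulrDl.
  move=> a _ a0 [s s0 ->]; exists (a * s); first by rewrite mulr_ge0// ltW.
  by rewrite /= scalerA mulrA.
- by move=> _ [s s0 ->]; rewrite /= sublinearZ.
have rle v : r v <= q v.
  have := rq (0 *: w, 0 * q w) v; rewrite /= scale0r mul0r addr0 subr0.
  by apply; exists 0; rewrite ?scale0r ?mul0r.
have := rq (1 *: w, 1 * q w) u (ex_intro2 _ _ 1 ler01 erefl).
by rewrite /= scale1r mul1r (qmin r sr rle); lra.
Qed.

(** Zorn's lemma: along a chain the infimum is finite because a sublinear
    functional below [p] is at least [- p (- u)] at [u]. *)
Lemma minimal_sublinear_ex p : sublinear p ->
  exists q, [/\ sublinear q, forall u, q u <= p u &
    forall r, sublinear r -> (forall u, r u <= q u) -> r = q].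
Proof.
move=> sp; pose T := {q : V -> R | sublinear q /\ forall u, q u <= p u}.
pose le (q r : T) := `[< forall u, sval r u <= sval q u >].
have [||| |q qmin] := @Zorn T le.
- by move=> q; apply/asboolP.
- move=> q r s /asboolP qr /asboolP rs; apply/asboolP => u.
  exact: le_trans (rs u) (qr u).
- move=> [q hq] [r hr] /asboolP/= qr /asboolP/= rq; apply: eq_exist.
  by apply/funext => u; apply/le_anti; rewrite qr rq.
- move=> A Atot; have [[q0 Aq0]|A0] := pselect (A !=set0); last first.
    have sp' : sublinear p /\ forall u, p u <= p u by split.
    by exists (exist _ p sp') => q Aq; case: A0; exists q.
  have [||||sq qF] := @sublinear_inf T A (fun t => sval t) (fun u => - p (- u)).
  + by exists q0.
  + move=> [q [sq qp]] u _ /=; have := sublinearN u sq.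
    by have := qp (- u); lra.
  + move=> q r u v Aq Ar; have [/asboolP h|/asboolP h] := Atot _ _ Aq Ar.
      by exists r => //; have := (svalP r).1.1 u v; have := h u; lra.
    by exists q => //; have := (svalP q).1.1 u v; have := h v; lra.
  + by move=> q a u Aq a0; exists q => //; exact: (svalP q).1.2.
  set q := fun u => _ in sq qF.
  have qp u : q u <= p u by apply: le_trans (qF _ u Aq0) ((svalP q0).2 u).
  by exists (exist _ q (conj sq qp)) => r Ar; apply/asboolP => u; exact: qF.
exists (sval q); split; [exact: (svalP q).1|exact: (svalP q).2|].
move=> r sr rq.
have rp u : r u <= p u by apply: le_trans (rq u) ((svalP q).2 u).
rewrite -(qmin (exist _ r (conj sr rp)))//; exact/asboolP.
Qed.

(** The Hahn-Banach theorem: a minimal sublinear minorant of [p] is additive,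
    and homogeneity for negative scalars follows from additivity. *)
Theorem linear_below_sublinear p : sublinear p ->
  exists f : {linear V -> R^o}, forall u, f u <= p u.
Proof.
move=> /minimal_sublinear_ex[q [sq qp /(minimal_sublinear_additive sq) qD]].
have qN u : q (- u) = - q u.
  by have := qD u (- u); rewrite subrr sublinear0//; lra.
have qL : linear (q : V -> R^o).
  move=> a u v; rewrite qD; congr (_ + _); change (q (a *: u) = a * q u).
  have [a0|a0] := leP 0 a; first exact: sublinearZ.
  by rewrite -[a]opprK scaleNr qN sublinearZ ?oppr_ge0 1?ltW// [RHS]mulNr.
pose f : {linear V -> R^o} := HB.pack (q : V -> R^o)
  (GRing.isLinear.Build R V R^o _ _ qL).
by exists f.
Qed.

End Sublinear.

(** * The dual ball: separation and compactness *)

Section DualBall.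
Variables (R : realType) (V : normedModType R).
Implicit Types (f t : {linear V -> R^o}) (u v : V).

(** The bound is one-sided, as Hahn-Banach provides it; applied at [- u] it
    bounds the absolute value. *)
Definition dual_ball : set {linear V -> R^o} :=
  [set f | forall u, f u <= `|u|].

Lemma dual_ball_norm f u : dual_ball f -> `|f u| <= `|u|.
Proof.
move=> fB; have := fB (- u); rewrite linearN normrN => fN.
by rewrite ler_norml fB andbT -[f u]opprK lerN2.
Qed.

Lemma functionalZ f (a : R) u : f (a *: u) = a * f u :> R.
Proof. exact: linearZ. Qed.

Lemma norm_sublinear : sublinear (fun u : V => `|u|).
Proof.
split=> [u v|a u a0]; first exact: ler_normD.
by rewrite normrZ gtr0_norm.
Qed.

(** The finite form of the separation of a convex hull from the open ball of
    radius [e].  The hypothesis is homogeneous, hence says that the cone of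
    the vectors [\sum_i m i *: w i] at prices [e * \sum_i m i] is dominated by
    the norm. *)
Lemma dual_ball_separation (I : finType) (w : I -> V) (e : R) :
  (forall m : I -> R, (forall i, 0 <= m i) ->
     e * (\sum_i m i) <= `|\sum_i m i *: w i|) ->
  exists2 f, dual_ball f & forall i, e <= f (w i).
Proof.
move=> we.
pose P := [set c : V * R | exists2 m : I -> R, (forall i, 0 <= m i) &
                      c = (\sum_i m i *: w i, e * \sum_i m i)].
have P0 : P (0, 0).
  exists (fun=> 0) => //; rewrite big1 ?big1 ?mulr0// => i _.
  by rewrite scale0r.
have [||q [sq qle qP]] := sublinear_shift (P := P) norm_sublinear.
- split; first by exists (0, 0).
    move=> _ _ [m m0 ->] [n n0 ->]; exists (fun i => m i + n i).
      by move=> i; exact: addr_ge0.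
    rewrite big_split mulrDr -big_split /=; congr (_, _).
    by apply: eq_bigr => i _; rewrite scalerDl.
  move=> a _ a0 [m m0 ->]; exists (fun i => a * m i).
    by move=> i; rewrite mulr_ge0// ltW.
  rewrite /= scaler_sumr mulrCA mulr_sumr; congr (_, _).
  by apply: eq_bigr => i _; rewrite scalerA.
- by move=> _ [m m0 ->]; exact: we.
have [f fq] := linear_below_sublinear sq; exists f.
  by move=> u; rewrite (le_trans (fq u))// (le_trans (qle _ u P0))// addr0
    subr0.
move=> i; rewrite -lerN2 -linearN (le_trans (fq _))//.
have := qP (w i, e); apply; exists (fun j => (j == i)%:R) => [j|]; first by [].
rewrite (bigD1 i)//= eqxx scale1r big1 ?addr0; last first.
  by move=> j /negbTE ->; rewrite scale0r.
by rewrite (bigD1 i)//= eqxx big1 ?addr0 ?mulr1// => j /negbTE ->.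
Qed.

Lemma norming_functional v : exists2 f, dual_ball f & f v = `|v|.
Proof.
have [m m0|f fB fv] := @dual_ball_separation unit (fun=> v) `|v|.
  rewrite -scaler_suml normrZ ger0_norm ?sumr_ge0//.
  by rewrite mulrC.
by exists f => //; apply/le_anti; rewrite fv// fB.
Qed.

Lemma ultra_fmap (T U : Type) (g : T -> U) (G : set_system T) :
  UltraFilter G -> UltraFilter (g @ G).
Proof.
move=> GU; split; first exact: fmap_proper_filter.
move=> H HF sGH; apply/seteqP; split => // A HA.
have [//|GnA] := in_ultra_setVsetC (g @^-1` A) GU.
have HnA : H (~` A) by exact: sGH.
by have [x []] := filter_ex (filterI HA HnA).
Qed.

Lemma ultra_bounded_cvg (T : Type) (G : set_system T) (g : T -> R) (M : R) :
  UltraFilter G -> (forall x, `|g x| <= M) -> cvg (g @ G).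
Proof.
move=> GU gM.
have := @segment_compact R (- M) M; rewrite compact_ultra => cpt.
have [|l [_ gl]] := cpt (g @ G) (ultra_fmap g GU); last by apply/cvg_ex;
  exists l.
apply: (@filterE _ G _ (g @^-1` _)) => x; rewrite /preimage/= in_itv/=.
by rewrite -ler_norml.
Qed.

(** Weak-star compactness of finite powers of the dual ball.  The finite
    subsets [C] of [A] form a directed set; tuples refuting every finite [C]
    have, along an ultrafilter on it, a pointwise limit, which is a tuple of
    the dual ball refuting all of [A]. *)
Lemma dual_ball_compactness (I : finType) (A : set V) (e : R) :
  (forall t : I -> {linear V -> R^o}, (forall i, dual_ball (t i)) ->
     exists2 a, A a & forall i, t i a < e) ->
  exists2 C : seq V, (forall c, c \in C -> A c) &
    forall t : I -> {linear V -> R^o}, (forall i, dual_ball (t i)) ->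
      exists2 c, c \in C & forall i, t i c < e.
Proof.
move=> hA; apply: contrapT => hC.
have /choice[t ht] : forall C : seq V, exists t : I -> {linear V -> R^o},
    (forall i, dual_ball (t i)) /\
    ((forall c, c \in C -> A c) -> forall c, c \in C -> ~ forall i, t i c < e).
  move=> C; have [CA|CA] := pselect (forall c, c \in C -> A c); last first.
    exists (fun=> \0) ; split => //.
    by move=> _ u /=.
  apply: contrapT => ht; apply: hC; exists C => // t tB.
  apply: contrapT => hc; apply: ht; exists t; split => // _ c cC tc.
  by apply: hc; exists c.
pose F : set_system (seq V) := [set P | exists2 C0 : seq V,
  (forall c, c \in C0 -> A c) &
  forall C : seq V, (forall c, c \in C -> A c) -> {subset C0 <= C} -> P C].
have FF : ProperFilter F.
  apply: Build_ProperFilter_ex.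
    by move=> P [C0 C0A C0P]; exists C0; exact: C0P.
  split.
  - by exists [::].
  - move=> P Q [C CA CP] [D DA DQ]; exists (C ++ D).
      by move=> c; rewrite mem_cat => /orP[/CA|/DA].
    move=> E EA sE; split; [apply: CP => //|apply: DQ => //] => c cC;
      by apply: sE; rewrite mem_cat cC ?orbT.
  - by move=> P Q PQ [C CA CP]; exists C => // D DA CD; apply: PQ; exact: CP.
have [G [GU sFG]] := ultraFilterLemma FF.
have cvgt i u : cvg ((fun C => t C i u : R) @ G).
  by apply: ultra_bounded_cvg => C; exact: dual_ball_norm ((ht C).1 i).
pose l i u : R^o := lim ((fun C => t C i u : R) @ G).
have lL i : linear (l i).
  move=> a u v; apply: cvg_lim => //.
  under eq_fun do rewrite linearP.
  apply: cvgD; last exact: cvgt.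
  by apply: cvgMl_tmp; exact: cvgt.
pose f i : {linear V -> R^o} :=
  HB.pack (l i) (GRing.isLinear.Build R V R^o _ _ (lL i)).
have [i u|a Aa fa] := hA f.
  rewrite /f/=; apply: limr_le; first exact: (cvgt i u).
  by apply: (@filterE _ G) => C; exact: (ht C).1.
suff : G set0 by exact: filter_not_empty.
have Glt : G [set C | forall i, t C i a < e].
  apply: filter_forall => i; have := fa i.
  exact: (cvgr_lt _ (cvgt i a)).
have Ga : G [set C : seq V | a \in C /\ forall c, c \in C -> A c].
  apply: sFG; exists [:: a] => [c|C CA sC]; first by rewrite inE => /eqP ->.
  by split => //; apply: sC; rewrite inE.
apply: filterS (filterI Glt Ga) => C [Clt [aC CA]].
exact: (ht C).2 CA a aC Clt.
Qed.

End DualBall.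

(** * Daugavet seminorms *)

Section DaugavetSeminorm.
Variables (R : realType) (X : normedModType R).
Implicit Types (q : X -> R) (u v x y z : X).

Definition seminorm q :=
  (forall u v, q (u + v) <= q u + q v) /\
  (forall a u, q (a *: u) = `|a| * q u).

Lemma seminorm0 q : seminorm q -> q 0 = 0.
Proof. by move=> sq; rewrite -(scale0r 0) sq.2 normr0 mul0r. Qed.

Lemma seminorm_ge0 q u : seminorm q -> 0 <= q u.
Proof.
move=> sq; have := sq.1 u (- u).
by rewrite subrr seminorm0// -scaleN1r sq.2 normrN1 mul1r; lra.
Qed.

Lemma seminorm_sum q (I : Type) (r : seq I) (F : I -> X) : seminorm q ->
  q (\sum_(i <- r) F i) <= \sum_(i <- r) q (F i).
Proof.
move=> sq; elim/big_ind2: _ => [|u a v b ua vb|i _] //;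
  first by rewrite seminorm0.
by rewrite (le_trans (sq.1 _ _))// lerD.
Qed.

Lemma seminormD q r : seminorm q -> seminorm r -> seminorm (fun u => q u + r u).
Proof.
move=> [qD qZ] [rD rZ]; split=> [u v|a u]; last by rewrite qZ rZ mulrDr.
by rewrite addrACA lerD.
Qed.

Lemma seminorm_norm_linear (Y : normedModType R) (S : {linear X -> Y}) :
  seminorm (fun u => `|S u|).
Proof.
by split=> [u v|a u]; [rewrite linearD ler_normD|rewrite linearZ normrZ].
Qed.

Definition daugavet_seminorm q := forall v y e, `|y| = 1 -> 0 < e ->
  exists z, [/\ `|z| = 1, q (z - y) < e & `|v| + 1 - e < `|v + z|].

(** A strong Daugavet operator only speaks of unit vectors [x].  For
    [v = `|v| x], the vectors [v + z] and [x + z] (or [`|v| (x + z)], when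
    [`|v| > 1]) differ by a vector of norm [`| `|v| - 1 |], which is exactly
    what the triangle inequality can lose. *)
Lemma strong_daugavetP (Y : normedModType R) (S : {linear X -> Y}) :
  strong_daugavet S <-> daugavet_seminorm (fun u => `|S u|).
Proof.
split=> [sdS v y e y1 e0|dS x y e x1 y1 e0]; last first.
  have [z [z1 zy zx]] := dS x y e y1 e0; exists z; split => //.
  by move: x1 zx; rewrite /unit_sphere/= [z + x]addrC => ->; lra.
have [->|v0] := eqVneq v 0.
  exists y; rewrite subrr linear0 normr0 add0r normr0 y1; split => //; lra.
have nv : 0 < `|v| by rewrite normr_gt0.
pose m := Num.max 1 `|v|.
have m1 : 1 <= m by rewrite le_max lexx.
have mv : `|v| <= m by rewrite le_max lexx orbT.
have m0 : 0 < m by lra.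
have em : 0 < e / m by rewrite divr_gt0.
have eme : e / m <= e by rewrite ler_pdivrMr// ler_peMr// ltW.
have [|z [z1 zy zx]] := sdS (`|v|^-1 *: v) y (e / m) _ y1 em.
  by rewrite /unit_sphere/= normrZ normfV normr_id mulVf ?gt_eqF.
exists z; split; [exact: z1|exact: lt_le_trans zy eme|].
set x := `|v|^-1 *: v in zx.
have vx : v = `|v| *: x by rewrite scalerA mulfV ?gt_eqF// scale1r.
have x1 : `|x| = 1 by rewrite normrZ normfV normr_id mulVf ?gt_eqF.
have [v1|v1] := leP `|v| 1.
  have zxE : z + x = (1 - `|v|) *: x + (v + z).
    by rewrite scalerBl scale1r -vx addrA subrK addrC.
  have := ler_normD ((1 - `|v|) *: x) (v + z).
  by rewrite -zxE normrZ x1 ger0_norm ?subr_ge0//; lra.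
have zxE : `|v| *: (z + x) = (`|v| - 1) *: z + (v + z).
  by rewrite scalerDr -vx scalerBl scale1r [v + z]addrC addrA subrK.
have := ler_normD ((`|v| - 1) *: z) (v + z).
rewrite -zxE !normrZ z1 normr_id ger0_norm ?subr_ge0; last exact: ltW.
have : `|v| * (2 - e / m) < `|v| * `|z + x| by rewrite ltr_pM2l.
have : `|v| * (e / m) <= e by rewrite mulrCA ler_piMr ?(ltW e0)// ler_pdivrMr//
  mul1r.
lra.
Qed.

(** A vector [z] of the ball with [`|v + z|] close to [`|v| + 1] has norm close
    to 1, so normalising it changes it by little in norm, and also
    for [q] because the change is a small multiple of [z] and [q z] is almost
    bounded by [q y]. *)
Lemma daugavet_seminorm_ball q : seminorm q ->
  (forall v y e, `|y| = 1 -> 0 < e ->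
     exists z, [/\ `|z| <= 1, q (z - y) < e & `|v| + 1 - e < `|v + z|]) ->
  daugavet_seminorm q.
Proof.
move=> sq qball v y e y1 e0.
have qy0 : 0 <= q y by exact: seminorm_ge0.
(* Normalising costs [2 * d * q z], and [q z <= q y + d]: the total error is
   at most [d * (2 * q y + 3)]. *)
pose d := Num.min 2^-1 (e / (2 * q y + 4)).
have d0 : 0 < d by rewrite lt_min; apply/andP; split; [lra|apply: divr_gt0;
  lra].
have d2 : d <= 2^-1 by rewrite ge_min lexx.
have de : d * (2 * q y + 4) <= e.
  by rewrite -ler_pdivlMr ?ge_min ?lexx ?orbT//; lra.
have [z [z1 zy vz]] := qball v y d y1 d0.
have zd : 1 - d < `|z| by have := ler_normD v z; lra.
have z0 : 0 < `|z| by lra.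
pose w := `|z|^-1 *: z.
have w1 : `|w| = 1 by rewrite normrZ normfV normr_id mulVf ?gt_eqF.
have wz : w - z = (`|z|^-1 - 1) *: z by rewrite scalerBl scale1r.
have iz : 1 <= `|z|^-1 by rewrite invf_ge1.
have nwz : `|w - z| = 1 - `|z|.
  rewrite wz normrZ ger0_norm ?subr_ge0// mulrBl mulVf ?gt_eqF//; lra.
have qwz : q (w - z) <= 2 * d * q z.
  rewrite wz sq.2 ger0_norm ?subr_ge0//; apply: ler_wpM2r;
    first exact: seminorm_ge0.
  have -> : `|z|^-1 - 1 = (1 - `|z|) / `|z| by rewrite mulrBl mul1r divff
    ?gt_eqF.
  rewrite ler_pdivrMr//.
  have : 2^-1 <= `|z| by lra.
  by move=> ?; nra.
have qz : q z <= q y + d.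
  by have := sq.1 y (z - y); rewrite [y + _]addrC subrK; lra.
exists w; split => //.
  have := sq.1 (w - z) (z - y); rewrite addrA subrK => h; nra.
have := ler_normB (v + w) (w - z).
rewrite opprB [z - w]addrC addrA addrK nwz.
nra.
Qed.

Lemma bounded_operator_gt0 (Y : normedModType R) (S : {linear X -> Y}) :
  bounded_operator S -> exists2 M : R, 0 < M & forall u, `|S u| <= M * `|u|.
Proof.
move=> [M SM]; exists (Num.max 1 M); first by rewrite lt_max ltr01.
by move=> u; rewrite (le_trans (SM u))// ler_wpM2r// le_max lexx orbT.
Qed.

Lemma bounded_family (I : finType) (f : I -> {linear X -> R^o}) :
  (forall i, bounded_operator (f i)) ->
  exists2 M : R, 0 < M & forall i u, `|f i u| <= M * `|u|.
Proof.
move=> fB.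
have /choice[M fM] : forall i, exists M : R, 0 < M /\ forall u, `|f i u| <= M *
  `|u|.
  by move=> i; have [M] := bounded_operator_gt0 (fB i); exists M.
exists (1 + \sum_i M i).
  by rewrite ltr_pwDl// sumr_ge0// => i _; rewrite ltW// (fM i).1.
move=> i u; rewrite (le_trans ((fM i).2 u))// ler_wpM2r// (bigD1 i)//=.
rewrite addrCA lerDl addr_ge0// sumr_ge0// => j _; rewrite ltW//.
exact: (fM j).1.
Qed.

Lemma functional_combination (I : finType) (f : I -> {linear X -> R^o}) (c : I
  -> R) :
  (forall i, bounded_operator (f i)) ->
  exists2 h : {linear X -> R^o}, bounded_operator h &
    forall u, h u = \sum_i c i * f i u.
Proof.
move=> /bounded_family[M M0 fM].
have hL : linear (fun u => \sum_i c i * f i u : R^o).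
  move=> a u v /=; rewrite scaler_sumr -big_split/=; apply: eq_bigr => i _.
  by rewrite linearP mulrDr; congr (_ + _); exact: mulrCA.
pose h : {linear X -> R^o} := HB.pack (fun u => \sum_i c i * f i u : R^o)
  (GRing.isLinear.Build R X R^o _ _ hL).
exists h => //; exists (\sum_i `|c i| * M) => u.
rewrite [`|h u|](_ : _ = `|\sum_i c i * f i u|)//.
rewrite (le_trans (ler_norm_sum _ _ _))// mulr_suml.
by apply: ler_sum => i _; rewrite normrM -mulrA ler_wpM2l.
Qed.

End DaugavetSeminorm.

(** * Narrow seminorms and finitely many functionals *)

Section NarrowSeminorm.
Variables (R : realType) (X : normedModType R).
Implicit Types (q : X -> R) (u v x y z : X).

Definition narrow_seminorm q := forall f : {linear X -> R^o},
  bounded_operator f -> daugavet_seminorm (fun u => q u + `|f u|).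

(** If [`|v + p|] is almost [`|v| + n], passing from [p] to [p / n] removes a
    vector of norm at most [n - 1]. *)
Lemma norm_add_scale_ge (n : nat) v p : (0 < n)%N -> `|p| <= n%:R ->
  `|v + p| - n%:R + 1 <= `|v + n%:R^-1 *: p|.
Proof.
move=> n0 pn; have n1 : (1 : R) <= n%:R by rewrite ler1n.
have i1 : (n%:R : R)^-1 <= 1 by rewrite invf_le1// (lt_le_trans ltr01).
have := ler_normD (v + n%:R^-1 *: p) ((1 - n%:R^-1) *: p).
rewrite -addrA -scalerDl [_^-1 + _]addrC subrK scale1r normrZ ger0_norm
  ?subr_ge0//.
have : (1 - n%:R^-1) * `|p| <= (1 - n%:R^-1) * n%:R.
  by rewrite ler_wpM2l// subr_ge0.
rewrite [X in _ <= X -> _]mulrBl mul1r mulVf ?gt_eqF ?(lt_le_trans ltr01)//;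
  lra.
Qed.

(** A random-walk estimate.  The functional controlled at each step is
    [\sum_i f i (p - n y) *: f i], so the new increment is almost orthogonal,
    in the coordinates [f i], to the sum of the previous ones; the square of
    the deviation then grows like [n] and not like [n ^ 2]. *)
Lemma narrow_seminorm_partial_sums q : seminorm q -> narrow_seminorm q ->
  forall (I : finType) (f : I -> {linear X -> R^o}) (K d : R) v y,
  (forall i, bounded_operator (f i)) -> `|y| = 1 -> 0 < d -> d <= 2^-1 ->
  (forall z, `|z| = 1 -> \sum_i f i (z - y) ^+ 2 <= K) ->
  forall n, exists p, [/\ `|p| <= n%:R, q (p - n%:R *: y) <= n%:R * d,
    `|v| + n%:R - n%:R * d <= `|v + p| &
    \sum_i f i (p - n%:R *: y) ^+ 2 <= n%:R * (K + 1)].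
Proof.
move=> sq nq I f K d v y fB y1 d0 d2 fK; elim=> [|n [p [pn qp vp fp]]].
  exists 0; rewrite scale0r subrr !mul0r normr0 seminorm0// !addr0 subr0;
    split => //.
  by rewrite big1// => i _; rewrite linear0 expr0n.
have [h hB hE] := functional_combination (fun i => f i (p - n%:R *: y)) fB.
have [z [z1 qz vz]] := nq h hB (v + p) y d y1 d0.
have q0 := seminorm_ge0 (z - y) sq; have h0 := normr_ge0 (h (z - y)).
have pzE : p + z - n.+1%:R *: y = (p - n%:R *: y) + (z - y).
  by rewrite -natr1 scalerDl scale1r opprD addrACA.
exists (p + z); rewrite pzE -natr1; split.
- by rewrite (le_trans (ler_normD _ _))// z1 lerD2r.
- by have := sq.1 (p - n%:R *: y) (z - y); lra.
- by rewrite [v + _]addrA; lra.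
have -> : \sum_i f i (p - n%:R *: y + (z - y)) ^+ 2 =
   \sum_i f i (p - n%:R *: y) ^+ 2 + 2 * h (z - y) + \sum_i f i (z - y) ^+ 2.
  rewrite hE mulr_sumr -!big_split/=; apply: eq_bigr => i _.
  by rewrite linearD; set a := f i _; set b := f i _; rewrite sqrrD mulr_natl.
have hz : h (z - y) <= 2^-1 by have := ler_norm (h (z - y)); lra.
have := fK z z1; lra.
Qed.

(** By [narrow_seminorm_partial_sums] the average of [n] well chosen unit
    vectors deviates from [y] by [O(n^-1/2)] on the family, while it stays
    close to [y] for [q] and almost orthogonal to [v]. *)
Lemma narrow_seminorm_family q : seminorm q -> narrow_seminorm q ->
  forall (I : finType) (f : I -> {linear X -> R^o}),
  (forall i, bounded_operator (f i)) ->
  daugavet_seminorm (fun u => q u + \sum_i `|f i u|).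
Proof.
move=> sq nq I f fB; apply: daugavet_seminorm_ball.
  apply: seminormD => //; split=> [u v|a u].
    rewrite -big_split; apply: ler_sum => i _; rewrite linearD;
      exact: ler_normD.
  rewrite mulr_sumr; apply: eq_bigr => i _.
  by rewrite linearZ; exact: normrM.
move=> v y e y1 e0.
have [M M0 fM] := bounded_family fB.
pose K := #|I|%:R * (2 * M) ^+ 2.
have fK z : `|z| = 1 -> \sum_i f i (z - y) ^+ 2 <= K.
  move=> z1; rewrite /K mulr_natl -sumr_const.
  apply: ler_sum => i _; rewrite -real_normK ?num_real// ler_pXn2r ?nnegrE//.
    rewrite (le_trans (fM i _))// mulrC ler_wpM2r ?(ltW M0)//.
    by rewrite (le_trans (ler_normB _ _))// z1 y1.
  by rewrite mulr_ge0// ltW.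
have K0 : 0 <= K by rewrite mulr_ge0// exprn_ge0// mulr_ge0// ltW.
pose k := e / (2 * (#|I|%:R + 1)).
have I0 : 0 < (#|I|%:R + 1 : R) by rewrite ltr_wpDl.
have k0 : 0 < k by rewrite divr_gt0// mulr_gt0.
(* The deviation on each functional is at most [k], and the family has [#|I|]
   members. *)
pose n := (Num.trunc ((K + 1) / k ^+ 2)).+1.
have Kn : (K + 1) / k ^+ 2 < n%:R by exact: truncnS_gt.
have n0 : 0 < (n%:R : R) by rewrite ltr0n.
pose d := Num.min 2^-1 (e / (2 * n%:R)).
have d0 : 0 < d by rewrite lt_min; apply/andP; split; [lra|apply: divr_gt0;
  lra].
have d2 : d <= 2^-1 by rewrite ge_min lexx.
have de : n%:R * d <= e / 2.
  by rewrite mulrC -ler_pdivlMr// ge_min -mulrA -invfM lexx orbT.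
have [p [pn qp vp fp]] := narrow_seminorm_partial_sums sq nq v fB y1 d0 d2 fK n.
exists (n%:R^-1 *: p).
have pyE : n%:R^-1 *: p - y = n%:R^-1 *: (p - n%:R *: y).
  by rewrite scalerBr scalerA mulVf ?gt_eqF// scale1r.
split.
- by rewrite normrZ normfV ger0_norm ?ler0n// ler_pdivrMl// mulr1.
- have qle : q (n%:R^-1 *: p - y) <= d.
    by rewrite pyE sq.2 normfV ger0_norm ?ler0n// ler_pdivrMl.
  have fle i : `|f i (n%:R^-1 *: p - y)| <= k.
    rewrite -(ler_pXn2r (n := 2)) ?nnegrE// ?(ltW k0)// real_normK ?num_real//.
    rewrite pyE linearZ [X in X ^+ 2 <= _]/(_ * _) exprMn exprVn ler_pdivrMl
      ?exprn_gt0//.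
    have : f i (p - n%:R *: y) ^+ 2 <= n%:R * (K + 1).
      rewrite (le_trans _ fp)// (bigD1 i)//= lerDl sumr_ge0// => j _.
      exact: sqr_ge0.
    move=> /le_trans; apply; rewrite expr2 -mulrA ler_pM2l//.
    by rewrite ltW// -ltr_pdivrMr ?exprn_gt0//.
  have : \sum_i `|f i (n%:R^-1 *: p - y)| <= #|I|%:R * k.
    by rewrite mulr_natl -sumr_const; apply: ler_sum => i _.
  have : d <= e / 2.
    by apply: le_trans de; rewrite ler_peMl ?(ltW d0)// ler1n.
  have : (#|I|%:R + 1) * k = e / 2 by rewrite /k; field; exact: lt0r_neq0.
  lra.
have := norm_add_scale_ge (n := n) v isT pn; lra.
Qed.

(** Several vectors [v] are handled one after the other: what was gained for
    [w] with the previous approximation [z1] is kept by controlling a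
    functional that norms [w + z1]. *)
Lemma narrow_seminorm_finite q : seminorm q -> narrow_seminorm q ->
  forall (W : seq X) (I : finType) (f : I -> {linear X -> R^o}) y e,
  (forall i, bounded_operator (f i)) -> `|y| = 1 -> 0 < e ->
  exists z, [/\ `|z| = 1, q (z - y) < e, forall i, `|f i (z - y)| < e &
    forall v, v \in W -> `|v| + 1 - e < `|v + z|].
Proof.
move=> sq nq; elim=> [|v W IHW] I f y e fB y1 e0.
  exists y; rewrite subrr seminorm0//; split => // i.
  by rewrite linear0 normr0.
have [z1 [z11 qz1 fz1 Wz1]] := IHW I f y (e / 2) fB y1 ltac:(lra).
have /choice[phi phiP] : forall w, exists g : {linear X -> R^o},
    dual_ball g /\ g (w + z1) = `|w + z1|.
  by move=> w; have [g gB gw] := norming_functional (w + z1); exists g.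
pose g (j : I + seq_sub W) := match j with inl i => f i | inr w => phi (val w)
  end.
have gB j : bounded_operator (g j).
  case: j => [i|w]; first exact: fB.
  by exists 1 => u; rewrite mul1r; apply: dual_ball_norm; exact: (phiP _).1.
have [z [z1' qz vz]] := narrow_seminorm_family sq nq gB v z11 (ltac:(lra) : 0 <
  e / 2).
have qge0 := seminorm_ge0 (z - z1) sq.
have gz j : `|g j (z - z1)| < e / 2.
  move: qz; rewrite (bigD1 j)//=.
  set s := \sum_(i | _) _.
  by have : 0 <= s by [exact: sumr_ge0]; lra.
have qle : q (z - z1) < e / 2.
  by move: qz; set s := \sum_i _; have : 0 <= s by [exact: sumr_ge0]; lra.
exists z; split => //.
- by have := sq.1 (z - z1) (z1 - y); rewrite addrA subrK; lra.
- move=> i; have := gz (inl i); have := fz1 i; rewrite /g => h1 h2.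
  have -> : z - y = (z - z1) + (z1 - y) by rewrite addrA subrK.
  by rewrite linearD; have := ler_normD (f i (z - z1)) (f i (z1 - y)); lra.
move=> w; rewrite inE => /predU1P[->|wW]; first by lra.
have := gz (inr (SeqSub wW)); rewrite /g/= => gzw.
have := (phiP w).1 (w + z).
have -> : w + z = (w + z1) + (z - z1).
  by rewrite -addrA [z1 + _]addrC subrK.
rewrite linearD (phiP w).2.
have := ler_norm (- phi w (z - z1)); rewrite normrN => h1 h2.
have := Wz1 w wW; lra.
Qed.

End NarrowSeminorm.

(** * The separating sequence *)

Section SeparatingSequence.
Variables (R : realType) (X Y : normedModType R).
Variables (q : X -> R) (T : {linear X -> Y}) (y : X) (e : R).
Hypotheses (sq : seminorm q) (nq : narrow_seminorm q).
Hypothesis (TB : bounded_operator T).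
Hypotheses (y1 : `|y| = 1) (e0 : 0 < e).

(** The condition on the norm of the full sum gives almost orthogonality to
    [v] of all convex combinations of [B] (see
    [spread_convex_combination]), and concatenates well ([spread_cat]). *)
Definition spread (W : seq X) (d : R) (B : seq X) :=
  (forall b, b \in B -> `|b| = 1 /\ q (b - y) < e) /\
  (forall v, v \in W -> `|v| + (size B)%:R - d < `|v + \sum_(b <- B) b|).

Lemma spread_cat W d d' B C : spread W d B ->
  spread [seq v + \sum_(b <- B) b | v <- W] d' C -> spread W (d + d') (B ++ C).
Proof.
move=> [B1 BW] [C1 CW]; split=> [b|v vW].
  by rewrite mem_cat => /orP[/B1|/C1].
have := CW _ (map_f (fun v => v + \sum_(b <- B) b) vW).
have := BW v vW; rewrite big_cat size_cat natrD /= -[v + _ + _]addrA; lra.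
Qed.

Lemma spread_sub W W' d d' B : {subset W <= W'} -> d' <= d ->
  spread W' d' B -> spread W d B.
Proof.
move=> sW dd [B1 BW]; split => // v /sW/BW; lra.
Qed.

(** No [L i] can be emptied by imposing [e <= t (T (b - y))] for the [b] of a
    family spread far enough, that is spread with respect to a suitable [W]
    and [d]. *)
Definition persistent (I : Type) (L : I -> set {linear Y -> R^o}) :=
  exists W d, 0 < d /\ forall B, spread W d B -> forall i,
    exists t, [/\ dual_ball t, L i t & forall b, b \in B -> e <= t (T (b - y))].

Definition split_at (I : Type) (L : I -> set {linear Y -> R^o}) (a : X)
    (ib : I * bool) : set {linear Y -> R^o} :=
  [set t | L ib.1 t /\
     if ib.2 then e <= t (T (a - y)) else t (T (a - y)) <= e / 2].

(** For any [a] of a spread family the halves [e <= t (T (a - y))] persist,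
    since [a] can be prepended to [B].  Suppose that for no such [a] all the
    halves [t (T (a - y)) <= e / 2] persist: every [a] has an index [i] and a
    spread family [B] emptying the half of [L i].  By compactness finitely
    many [a] are enough to have, for every tuple [t] of the dual ball, one of
    them with [t i (T (a - y)) < e / 2] for all [i] at once.  The concatenation
    of their families [B] is spread, so each [L i] still has a [t i] with
    [e <= t i (T (b - y))] on it, and the [a] provided by compactness
    contradicts the choice of its own [B]. *)
Lemma persistent_split (I : finType) (L : I -> set {linear Y -> R^o}) :
  persistent L -> exists a, `|a| = 1 /\ persistent (split_at L a).
Proof.
move=> [W [d [d0 HW]]].
pose U := [set a | [/\ `|a| = 1, q (a - y) < e &
  forall v, v \in W -> `|v| + 1 - d / 2 < `|v + a|]].
suff [a [Ua [W' [d' [d'0 HW']]]]] : exists a, U a /\ exists W' d', 0 < d' /\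
    forall B, spread W' d' B -> forall i, exists t, [/\ dual_ball t,
      L i t /\ t (T (a - y)) <= e / 2 & forall b, b \in B -> e <= t (T (b -
        y))].
  have [a1 qa Wa] := Ua.
  exists a; split => //.
  exists (W' ++ [seq v + a | v <- W]), (Num.min d' (d / 2)); split.
    by rewrite lt_min d'0/=; lra.
  move=> B BW [i []]; last first.
    apply: HW'; apply: spread_sub BW; last by rewrite ge_min lexx.
    by move=> v vW; rewrite mem_cat vW.
  have [|t [tB Lt tb]] := HW (a :: B) _ i.
    rewrite -cat1s (_ : d = d / 2 + d / 2); last by lra.
    apply: spread_cat; first split.
    - by move=> b; rewrite inE => /eqP ->.
    - by move=> v /Wa; rewrite big_seq1.
    - rewrite big_seq1; apply: spread_sub BW; last by rewrite ge_min lexx orbT.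
      by move=> v vW; rewrite mem_cat vW orbT.
  exists t; split => //=.
    by split => //; apply: tb; rewrite inE eqxx.
  by move=> b bB; apply: tb; rewrite inE bB orbT.
apply: contrapT => noa.
have kill a W' d' : U a -> 0 < d' -> exists B, spread W' d' B /\
    exists i, forall t, dual_ball t -> L i t -> t (T (a - y)) <= e / 2 ->
      exists2 b, b \in B & t (T (b - y)) < e.
  move=> Ua d'0; apply: contrapT => noB; apply: noa; exists a; split => //.
  exists W', d'; split => // B BW i; apply: contrapT => not.
  apply: noB; exists B; split => //; exists i => t tB Lt ta.
  apply: contrapT => nob; apply: not; exists t; split => // b bB.
  by rewrite leNgt; apply/negP => tb; apply: nob; exists b.
pose A := [set T (a - y) | a in U].
(* Narrowness puts 0 in the weak closure of [A], which is what compactness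
   asks for. *)
have [t tB|C CA hC] := @dual_ball_compactness R Y I A (e / 2).
  have [|M M0 TM] := @bounded_operator_gt0 R X Y T; first exact: TB.
  have fB i : bounded_operator (t i \o T : X -> R^o).
    by exists M => u; rewrite (le_trans (dual_ball_norm _ (tB i))).
  have h0 : 0 < Num.min e (d / 2) / 2.
    by rewrite divr_gt0// lt_min e0/=; lra.
  have he : Num.min e (d / 2) <= e by rewrite ge_min lexx.
  have hd : Num.min e (d / 2) <= d / 2 by rewrite ge_min lexx orbT.
  have [z [z1 qz fz Wz]] := narrow_seminorm_finite sq nq W
    (f := fun i => (t i \o T : {linear X -> R^o})) fB y1 h0.
  exists (T (z - y)).
    by exists z => //; split => //; [lra|move=> v /Wz; lra].
  by move=> i; have := fz i => /= h; have := ler_norm (t i (T (z - y))); lra.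
have killC : forall D : seq Y, (forall c, c \in D -> A c) -> forall W' d', 0 <
  d' ->
    exists B, spread W' d' B /\ forall c, c \in D -> exists i, forall t,
      dual_ball t -> L i t -> t c <= e / 2 ->
      exists2 b, b \in B & t (T (b - y)) < e.
  elim=> [|c D IHD] DA W' d' d'0.
    exists [::]; split => //; split => // v _.
    by rewrite big_nil !addr0; lra.
  have [a Ua ac] : A c by apply: DA; rewrite inE eqxx.
  have [B [BW [i Bi]]] := kill a W' (d' / 2) Ua ltac:(lra).
  have [|B' [BW' B'D]] := IHD _ [seq v + \sum_(b <- B) b | v <- W'] (d' / 2)
    ltac:(lra).
    by move=> c' c'D; apply: DA; rewrite inE c'D orbT.
  exists (B ++ B'); split.
    by rewrite (_ : d' = d' / 2 + d' / 2); [exact: spread_cat|lra].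
  move=> c'; rewrite inE => /predU1P[->|c'D].
    exists i => t tB Lt; rewrite -ac => /(Bi t tB Lt)[b bB tb].
    by exists b => //; rewrite mem_cat bB.
  have [j Bj] := B'D c' c'D; exists j => t tB Lt /(Bj t tB Lt)[b bB tb].
  by exists b => //; rewrite mem_cat bB orbT.
have [B [BW Bkill]] := killC C CA W d d0.
have /choice[t tP] := HW B BW.
have [|c cC tc] := hC t; first by move=> i; have [] := tP i.
have [i Bi] := Bkill c cC; have [tB Lt tb] := tP i.
have [b bB] := Bi (t i) tB Lt (ltW (tc i)).
by rewrite ltNge tb.
Qed.

Definition pattern_set (s : seq X) (f : {ffun 'I_(size s) -> bool}) :
    set {linear Y -> R^o} :=
  [set t | forall k : 'I_(size s),
     if f k then e <= t (T (nth 0 s k - y)) else t (T (nth 0 s k - y)) <= e /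
       2].

Lemma persistent_pattern_rcons s a :
  persistent (split_at (@pattern_set s) a) -> persistent (@pattern_set (rcons s
    a)).
Proof.
move=> [W [d [d0 H]]]; exists W, d; split => // B BW f.
have sz : size (rcons s a) = (size s).+1 by rewrite size_rcons.
pose f' k := if insub k is Some i then f i else false.
have [t [tB [/= tf ta] tb]] := H B BW ([ffun k : 'I_(size s) => f' k], f' (size
  s)).
exists t; split => // k.
have fk : f k = f' k by rewrite /f' valK.
rewrite fk nth_rcons; have := ltn_ord k; rewrite {2}sz ltnS leq_eqVlt.
move=> /predU1P[ks|ks]; first by rewrite ks ltnn eqxx.
by have := tf (Ordinal ks); rewrite ffunE /= ks.
Qed.

(** Iterating [persistent_split] doubles the number of sets at each step and
    keeps all of them nonempty. *)
Lemma separating_sequence : persistent (@pattern_set [::]) ->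
  exists a : nat -> X, (forall n, `|a n| = 1) /\
    forall (f : nat -> bool) n, exists2 t : {linear Y -> R^o}, dual_ball t &
      forall k, (k < n)%N ->
        if f k then e <= t (T (a k - y)) else t (T (a k - y)) <= e / 2.
Proof.
move=> P0.
pose Q s := persistent (@pattern_set s).
pose S := {s : seq X | Q s}.
have /choice[g gP] : forall s : S, exists a, `|a| = 1 /\
    persistent (@pattern_set (rcons (sval s) a)).
  move=> [s Ps]; have [a [a1 /persistent_pattern_rcons Pa]] := persistent_split
    Ps.
  by exists a.
pose s n : S := iter n (fun s => exist Q _ (gP s).2) (exist Q _ P0).
pose a n := g (s n).
have sE n : sval (s n) = mkseq a n.
  elim: n => [|n IHn] //=.
  by rewrite -/(s n) IHn /mkseq -[in RHS]addn1 iotaD map_cat/= add0n cats1.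
exists a; split => [n|f n]; first exact: (gP _).1.
have [W [d [d0 H]]] := svalP (s n).
have [|t [tB tf _]] := H [::] _ [ffun k => f (val k)].
  by split => // v _; rewrite big_nil !addr0; lra.
exists t => // k kn.
have kn' : (k < size (sval (s n)))%N by rewrite sE size_mkseq.
have := tf (Ordinal kn'); rewrite ffunE/=.
by rewrite [nth _ _ _](_ : _ = a k)// sE nth_mkseq.
Qed.

End SeparatingSequence.

(** * Copies of l1 *)

Section Bilipschitz.
Variables (R : realType) (X Y : normedModType R).

Lemma lipschitz_within_continuous (E : set X) (f : X -> Y) (M : R) :
  (forall x z, E x -> E z -> `|f x - f z| <= M * `|x - z|) ->
  {within E, continuous f}.
Proof.
move=> fM; apply/subspace_continuousP => x Ex; apply/cvgrPdist_lt => e e0.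
have m0 : 0 < Num.max M 1 by rewrite lt_max ltr01 orbT.
rewrite near_withinE; near=> z => Ez.
apply: le_lt_trans (fM _ _ Ex Ez) _.
apply: (@le_lt_trans _ _ (Num.max M 1 * `|x - z|)).
  by rewrite ler_wpM2r// le_max lexx.
rewrite -ltr_pdivlMl//; near: z.
by apply: cvgr_dist_lt => //; rewrite mulr_gt0 ?invr_gt0.
Unshelve. all: by end_near. Qed.

End Bilipschitz.

Lemma bilipschitz_isomorphism_on (R : realType) (X Y : normedModType R)
    (E : set X) (f : X -> Y) (M c : R) : 0 < c ->
  (forall x z, E x -> E z -> `|f x - f z| <= M * `|x - z|) ->
  (forall x z, E x -> E z -> c * `|x - z| <= `|f x - f z|) ->
  isomorphism_on E f.
Proof.
move=> c0 fM fc; split; first exact: lipschitz_within_continuous fM.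
pose g (y : Y) : X := if pselect (exists2 x, E x & f x = y) is left h
  then projT1 (cid2 h) else 0.
have gP x : E x -> g (f x) = x.
  move=> Ex; rewrite /g; case: pselect => [h|[]]; last by exists x.
  case: cid2 => z Ez /= fzx.
  apply/eqP; rewrite -subr_eq0 -normr_le0 -(pmulr_rle0 _ c0).
  by rewrite (le_trans (fc _ _ Ez Ex))// fzx subrr normr0.
exists g; split => //; apply: (@lipschitz_within_continuous _ _ _ _ _ c^-1).
move=> _ _ [x Ex <-] [z Ez <-]; rewrite !gP//.
by rewrite ler_pdivlMl// fc.
Qed.

Section Ell1Copy.
Variables (R : realType) (X : completeNormedModType R) (Y : normedModType R).
Variables (T : {linear X -> Y}) (a : nat -> X) (M c : R).
Hypotheses (TB : bounded_operator T) (c0 : 0 < c).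
Hypothesis (aM : forall n, `|a n| <= M).
Hypothesis (Ta : forall (u : nat -> R) n,
  c * (\sum_(0 <= k < n) `|u k|) <= `|\sum_(0 <= k < n) u k *: T (a k)|).

(** The operator sending the unit vector basis of l1 to [a]. *)
Definition ell1_synthesis (u : ell1 R) : X :=
  limn (series (fun k => u k *: a k)).

Lemma ell1_synthesis_ncvg (u : ell1 R) :
  cvgn [normed series (fun k => u k *: a k)].
Proof.
apply: (@series_le_cvg _ _ (fun k => M * `|u k|)).
- by move=> n; rewrite normr_ge0.
- by move=> n; rewrite mulr_ge0// (le_trans _ (aM n)).
- by move=> n /=; rewrite normrZ mulrC ler_wpM2r.
rewrite [X in cvgn X](_ : _ = (fun n => M * abs_series u n)).
  by apply: is_cvgMl_tmp; exact: ell1_cvg.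
by apply/funext => n; rewrite abs_seriesE mulr_sumr.
Qed.

Lemma ell1_synthesis_cvg (u : ell1 R) :
  series (fun k => u k *: a k) @ \oo --> ell1_synthesis u.
Proof. exact/normed_cvg/ell1_synthesis_ncvg. Qed.

Lemma ell1_synthesis_linear : linear ell1_synthesis.
Proof.
move=> b u v; apply: cvg_lim => //.
rewrite (_ : series _ = (fun n => b *: series (fun k => u k *: a k) n +
   series (fun k => v k *: a k) n)); last first.
  apply/funext => n; rewrite !seriesEnat/= scaler_sumr -big_split/=.
  by apply: eq_bigr => k _; rewrite scalerA -scalerDl.
apply: cvgD; last exact: ell1_synthesis_cvg.
by apply: cvgZl_tmp; exact: ell1_synthesis_cvg.
Qed.

HB.instance Definition _ :=
  GRing.isLinear.Build R (ell1 R) X _ ell1_synthesis ell1_synthesis_linear.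

Lemma ell1_synthesis_le (u : ell1 R) : `|ell1_synthesis u| <= M * `|u|.
Proof.
rewrite (le_trans (lim_series_norm (@ell1_synthesis_ncvg u)))//.
apply: limr_le; first exact: ell1_synthesis_ncvg.
apply: nearW => n /=.
have M0 : 0 <= M by rewrite (le_trans _ (aM 0)).
apply: (@le_trans _ _ (M * abs_series u n)).
  rewrite abs_seriesE mulr_sumr; apply: ler_sum => k _.
  by rewrite normrZ mulrC ler_wpM2r.
rewrite ler_wpM2l//; apply: nondecreasing_cvgn_le; last exact: ell1_cvg.
by apply/nondecreasing_seqP => k; rewrite !abs_seriesE big_nat_recr//= lerDl.
Qed.

Lemma ell1_synthesis_ge (u : ell1 R) : c * `|u| <= `|T (ell1_synthesis u)|.
Proof.
have [L L0 TL] := bounded_operator_gt0 TB.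
have Tc : continuous T.
  apply/bounded_linear_continuous/linear_boundedP.
  exists L; split; first exact: num_real.
  by move=> r /ltW Lr x; rewrite (le_trans (TL x))// ler_wpM2r.
have h1 : (fun n => c * abs_series u n) @ \oo --> c * `|u|.
  by apply: cvgMl_tmp; exact: ell1_cvg.
have h2 : (fun n => `|T (series (fun k => u k *: a k) n)|) @ \oo -->
    `|T (ell1_synthesis u)|.
  by apply: cvg_norm; apply: continuous_cvg;
    [exact: Tc|exact: ell1_synthesis_cvg].
apply: (ler_cvg_to h1 h2); apply: nearW => n.
rewrite abs_seriesE (le_trans (Ta u n))// seriesEnat/= linear_sum.
by under [in leRHS]eq_bigr do rewrite linearZ.
Qed.

Lemma fixes_copy_of_ell1_span : fixes_copy_of_ell1 T.
Proof.
have [L L0 TL] := bounded_operator_gt0 TB.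
have Jge u : c / L * `|u| <= `|ell1_synthesis u|.
  rewrite mulrAC ler_pdivrMr// mulrC [leRHS]mulrC.
  by rewrite mulrC (le_trans (ell1_synthesis_ge u)).
exists (range ell1_synthesis); split.
  exists ell1_synthesis; split => //.
  apply: (@bilipschitz_isomorphism_on _ _ _ _ _ M (c / L)).
  - by rewrite divr_gt0.
  - by move=> u v _ _; rewrite -linearB; exact: ell1_synthesis_le.
  - by move=> u v _ _; rewrite -linearB; exact: Jge.
have M0 : 0 <= M by rewrite (le_trans _ (aM 0)).
apply: (@bilipschitz_isomorphism_on _ _ _ _ _ L (c / (M + 1))).
- by rewrite divr_gt0// ltr_wpDl.
- by move=> x z _ _; rewrite -linearB; exact: TL.
- move=> _ _ [u _ <-] [v _ <-]; rewrite -!linearB.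
  rewrite (le_trans _ (ell1_synthesis_ge (u - v)))//.
  rewrite mulrAC ler_pdivrMr ?ltr_wpDl// -mulrA ler_wpM2l ?(ltW c0)//.
  rewrite (le_trans (ell1_synthesis_le _))// mulrC ler_wpM2l// lerDl//.
Qed.

End Ell1Copy.

Section Rosenthal.
Variables (R : realType) (Y : normedModType R).

(** Rosenthal's inequality: functionals [t] and [s] separating the indices by
    the sign of [u] in opposite ways give
    [(t - s) (\sum_k u k *: w k) >= e / 2 * \sum_k `|u k|], and [t - s] has norm
    at most 2. *)
Lemma separated_ell1_lower_bound (w : nat -> Y) (e : R) :
  (forall (f : nat -> bool) n, exists2 t : {linear Y -> R^o}, dual_ball t &
      forall k, (k < n)%N -> if f k then e <= t (w k) else t (w k) <= e / 2) ->
  forall (u : nat -> R) n,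
  e / 4 * (\sum_(0 <= k < n) `|u k|) <= `|\sum_(0 <= k < n) u k *: w k|.
Proof.
move=> hw u n.
have [t tB tw] := hw (fun k => 0 <= u k) n.
have [s sB sw] := hw (fun k => u k < 0) n.
set x := \sum_(0 <= k < n) u k *: w k.
have : e / 2 * (\sum_(0 <= k < n) `|u k|) <= t x - s x.
  have gx (g : {linear Y -> R^o}) :
      g x = \sum_(0 <= k < n) u k * g (w k) :> R.
    by rewrite linear_sum; apply: eq_bigr => k _; rewrite linearZ.
  rewrite !gx -sumrB mulr_sumr !big_mkord; apply: ler_sum => k _.
  have := tw k (ltn_ord k); have := sw k (ltn_ord k).
  have [uk|uk] := ltP (u k) 0; move=> sk tk.
    rewrite ltr0_norm//; nra.
  rewrite ger0_norm//; nra.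
have := ler_norm (t x); have := dual_ball_norm x tB.
have := ler_norm (- s x); rewrite normrN; have := dual_ball_norm x sB.
lra.
Qed.

End Rosenthal.

(** * Operators that do not fix a copy of l1 *)

Section NarrowPlusNotFixing.
Variables (R : realType) (X : completeNormedModType R) (Y : normedModType R).
Variables (q : X -> R) (T : {linear X -> Y}).
Hypotheses (sq : seminorm q) (nq : narrow_seminorm q).
Hypotheses (TB : bounded_operator T) (Tl1 : ~ fixes_copy_of_ell1 T).

(** A convex combination of [B] is the full sum minus
    [\sum_i (1 - l i) *: b i], a vector of norm at most [size B - 1]; so almost
    orthogonality of the full sum to [v] is enough. *)
Lemma spread_convex_combination (v y : X) (e d : R) (B : seq X)
    (l : 'I_(size B) -> R) : spread q y e [:: v] d B ->
  (forall i, 0 <= l i) -> \sum_i l i = 1 ->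
  let z := \sum_i l i *: nth 0 B i in
  [/\ `|z| <= 1, q (z - y) <= e & `|v| + 1 - d < `|v + z|].
Proof.
move=> [B1 /(_ v (mem_head _ _)) Bv] l0 l1 z.
have Bi (i : 'I_(size B)) := B1 _ (mem_nth 0 (ltn_ord i)).
have l_le1 i : l i <= 1.
  by rewrite -l1 (bigD1 i)//= lerDl sumr_ge0.
split.
- rewrite (le_trans (ler_norm_sum _ _ _))// -[leRHS]l1; apply: ler_sum => i _.
  by rewrite normrZ (Bi i).1 mulr1 ger0_norm.
- have -> : z - y = \sum_i l i *: (nth 0 B i - y).
    under eq_bigr do rewrite scalerBr.
    by rewrite sumrB -scaler_suml l1 scale1r.
  rewrite (le_trans (seminorm_sum _ _ sq))// -[e]mul1r -l1 mulr_suml.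
  apply: ler_sum => i _; rewrite sq.2 ger0_norm// ler_wpM2l// ltW//.
  exact: (Bi i).2.
have : `|v + \sum_(b <- B) b| <= `|v + z| + ((size B)%:R - 1).
  have -> : v + \sum_(b <- B) b = (v + z) + \sum_i (1 - l i) *: nth 0 B i.
    rewrite -addrA -big_split/= (big_nth 0) big_mkord; congr (_ + _).
    by apply: eq_bigr => i _; rewrite -scalerDl addrC subrK scale1r.
  rewrite (le_trans (ler_normD _ _))// lerD2l (le_trans (ler_norm_sum _ _ _))//.
  have <- : \sum_(i < size B) (1 - l i) = (size B)%:R - 1.
    by rewrite sumrB l1 sumr_const card_ord.
  apply: ler_sum => i _.
  by rewrite normrZ (Bi i).1 mulr1 ger0_norm// subr_ge0.
lra.
Qed.

(** If [q + `|T|] failed to be a Daugavet seminorm, Hahn-Banach would make the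
    whole dual ball persistent, and the separating sequence obtained from it
    would span a copy of l1 fixed by [T]. *)
Lemma daugavet_seminorm_not_fixing_ell1 :
  daugavet_seminorm (fun u => q u + `|T u|).
Proof.
apply: daugavet_seminorm_ball.
  by apply: seminormD => //; exact: seminorm_norm_linear.
move=> v y e y1 e0; apply: contrapT => noz.
have e20 : 0 < e / 2 by lra.
have P0 : persistent q T y (e / 2) (pattern_set T y (e / 2) (s := [::])).
  exists [:: v], e; split => // B BW f.
  have [m m0|t tB tb] :=
      @dual_ball_separation _ Y 'I_(size B) (fun i => T (nth 0 B i - y)) (e /
        2).
    set w := \sum_i _ *: _.
    have : 0 <= \sum_i m i by exact: sumr_ge0.
    rewrite le0r => /predU1P[->|s0]; first by rewrite mulr0.
    rewrite leNgt; apply/negP => wlt; apply: noz.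
    pose l i := m i / (\sum_i m i).
    have l0 i : 0 <= l i by rewrite divr_ge0// ltW.
    have l1 : \sum_i l i = 1 by rewrite -mulr_suml mulfV ?gt_eqF.
    have [z1 qz vz] := spread_convex_combination BW l0 l1.
    eexists; split; [exact: z1| |exact: vz].
    suff : `|T (\sum_i l i *: nth 0 B i - y)| < e / 2 by lra.
    have -> : T (\sum_i l i *: nth 0 B i - y) = (\sum_i m i)^-1 *: w.
      rewrite -[y]scale1r -l1 scaler_suml -sumrB linear_sum scaler_sumr.
      apply: eq_bigr => i _; rewrite -scalerBr linearZ scalerA mulrC //.
    by rewrite normrZ normfV gtr0_norm// ltr_pdivrMl// mulrC.
  exists t; split => //; first by move=> [].
  by move=> b bB; have /(nthP 0)[i iB <-] := bB; exact: (tb (Ordinal iB)).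
have [a [a1 aP]] := separating_sequence sq nq TB y1 e20 P0.
apply: Tl1.
apply: (@fixes_copy_of_ell1_span _ _ _ T (fun k => a k - y) 2 (e / 2 / 4)) =>
  //.
- by lra.
- by move=> n; rewrite (le_trans (ler_normB _ _))// a1 y1; lra.
- exact: separated_ell1_lower_bound aP.
Qed.

End NarrowPlusNotFixing.

Lemma narrow_seminorm_functional (R : realType) (X : normedModType R)
    (q : X -> R) (f : {linear X -> R^o}) :
  seminorm q -> narrow_seminorm q -> bounded_operator f ->
  narrow_seminorm (fun u => q u + `|f u|).
Proof.
move=> sq nq fB g gB.
pose h b := if b then f else g.
have hB b : bounded_operator (h b) by case: b.
have := narrow_seminorm_family sq nq hB.
congr daugavet_seminorm; apply/funext => u.
by rewrite big_bool/= addrA.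
Qed.

(** Adding a functional [f] to [q + `|T|] is adding [T] to the narrow seminorm
    [q + `|f|]. *)
Lemma narrow_seminorm_not_fixing_ell1 (R : realType)
    (X : completeNormedModType R) (Y : normedModType R) (q : X -> R)
    (T : {linear X -> Y}) :
  seminorm q -> narrow_seminorm q -> bounded_operator T ->
  ~ fixes_copy_of_ell1 T -> narrow_seminorm (fun u => q u + `|T u|).
Proof.
move=> sq nq TB Tl1 f fB.
have sf := seminorm_norm_linear f.
have := daugavet_seminorm_not_fixing_ell1 (seminormD sq sf)
  (narrow_seminorm_functional sq nq fB) TB Tl1.
by congr daugavet_seminorm; apply/funext => u; rewrite addrAC.
Qed.

(** * Spaces with the Daugavet property *)

Section DaugavetProperty.
Variables (R : realType) (X : normedModType R).
Hypothesis XD : daugavet_property X.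
Implicit Types (f : {linear X -> R^o}) (u v x y z : X).

(** The Daugavet equation for [u |-> f u *: x], with [x = v / `|v|], provides
    [z] with [f z] almost maximal on the ball and [`|z + f z *: x|] almost
    [1 + f z].  When moreover [f z >= `|v|], replacing [f z *: x] by
    [v = `|v| *: x] costs exactly [f z - `|v|]. *)
Lemma daugavet_large_slice f v (d : R) : bounded_operator f -> v != 0 ->
  0 < d -> (exists2 u, `|u| <= 1 & `|v| + d <= f u) ->
  exists z, [/\ `|z| <= 1, forall u, `|u| <= 1 -> f u <= f z + d &
    `|v| + 1 - d < `|v + z|].
Proof.
move=> /bounded_operator_gt0[M M0 fM] v0 d0 [u1 u11 fu1].
have nv : 0 < `|v| by rewrite normr_gt0.
have fu10 : 0 < (f u1 : R) by lra.
pose x := `|v|^-1 *: v.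
have x1 : `|x| = 1 by rewrite normrZ normfV normr_id mulVf ?gt_eqF.
have x0 : x != 0 by rewrite -normr_eq0 x1 oner_eq0.
have SL : linear (fun u => (f u : R) *: x).
  by move=> a u w /=; rewrite linearP scalerDl -scalerA.
pose S : {linear X -> X} := HB.pack (fun u => (f u : R) *: x)
  (GRing.isLinear.Build R X X _ _ SL).
have SE u : S u = (f u : R) *: x by [].
have nS u : `|S u| = `|f u : R| by rewrite SE normrZ x1 mulr1.
have SB : bounded_operator S by exists M => u; rewrite nS; exact: fM.
have S1 : rank_one S.
  exists x => //; apply/seteqP; split=> _ [a _ <-]; first by exists (f a : R).
  exists ((a / f u1) *: u1) => //; rewrite SE.
  by rewrite functionalZ divfK// lt0r_neq0.
have := XD SB S1; rewrite /opnorm.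
set A := [set `|S u| | u in _]; set B := [set `|_ + _| | _ in _] => BA.
have fA u : `|u| <= 1 -> `|f u : R| <= sup A.
  move=> u1'; apply: ub_le_sup; last by exists u.
  exists M => _ [w w1 <-]; rewrite nS (le_trans (fM w))// -[leRHS]mulr1.
  by rewrite ler_wpM2l// ltW.
have [|_ [u u1' <-]] := @sup_adherent _ B d d0.
  split; first by exists `|0 + S 0|, 0 => //=; rewrite normr0.
  exists (1 + M) => _ [w w1 <-]; rewrite (le_trans (ler_normD _ _))// lerD//.
  rewrite nS (le_trans (fM w))// -[leRHS]mulr1.
  by rewrite ler_wpM2l// ltW.
rewrite BA => uS.
have [z [z1 fz0 zS]] : exists z, [/\ `|z| <= 1, 0 <= (f z : R) & 1 + sup A - d
  < `|z + S z|].
  have [fu|fu] := leP 0 (f u : R); first by exists u.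
  exists (- u); rewrite normrN !linearN -opprD normrN; split => //.
  by rewrite oppr_ge0 ltW.
have zfz : `|z + S z| <= `|z| + f z.
  by rewrite (le_trans (ler_normD _ _))// nS ger0_norm.
exists z; split => //.
  move=> w w1; have := fA w w1; have := ler_norm (f w : R); lra.
have vx : v = `|v| *: x by rewrite scalerA mulfV ?gt_eqF// scale1r.
have vfz : `|v| <= f z.
  have := fA u1 u11; have := ler_norm (f u1 : R); lra.
have zSE : z + S z = (v + z) + ((f z : R) - `|v|) *: x.
  by rewrite SE scalerBl -vx [v + z]addrC -addrA [v + _]addrC subrK.
have := ler_normD (v + z) (((f z : R) - `|v|) *: x).
rewrite -zSE normrZ x1 mulr1 ger0_norm ?subr_ge0//.
have := fA z z1; have := ler_norm (f z : R); lra.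
Qed.

(** Multiplying [f] by a large [k >= 1] makes [daugavet_large_slice] applicable
    and only improves the bound on [f].  For [v = 0] any nonzero vector may
    stand in for [v]: almost orthogonality to it forces [`|z|] to be almost
    1. *)
Lemma daugavet_slice f v (d : R) : bounded_operator f -> (exists u, f u != 0) ->
  0 < d -> exists z, [/\ `|z| <= 1, forall u, `|u| <= 1 -> f u <= f z + d &
    `|v| + 1 - d < `|v + z|].
Proof.
move=> fB [u0 fu0] d0.
have u00 : u0 != 0 by apply: contraNneq fu0 => ->; rewrite linear0.
have [u1 u11 fu1] : exists2 u, `|u| <= 1 & 0 < (f u : R).
  have nu0 : 0 < `|u0| by rewrite normr_gt0.
  exists ((Num.sg (f u0 : R) / `|u0|) *: u0).
    rewrite normrZ normrM normfV normr_id divfK ?gt_eqF//.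
    by rewrite normr_sg; case: (_ != _).
  rewrite functionalZ mulrAC -normrEsg.
  by rewrite divr_gt0// normr_gt0.
pose v' := if v == 0 then u0 else v.
have v'0 : v' != 0 by rewrite /v'; case: ifPn.
pose k : R := 1 + (`|v'| + d) / f u1.
have k1 : 1 <= k by rewrite lerDl divr_ge0 ?(ltW fu1)// addr_ge0// ltW.
have [h hB hE] := @functional_combination _ _ unit (fun=> f) (fun=> k) (fun=>
  fB).
have hk u : h u = k * f u :> R by rewrite hE big_const cardT enumT unlock /=
  addr0.
have [|z [z1 hz vz]] := daugavet_large_slice hB v'0 d0.
  exists u1 => //; rewrite hk /k mulrDl mul1r divfK ?gt_eqF//; lra.
exists z; split => //.
  move=> u uu; have := hz u uu; rewrite !hk => kk.
  have : k * (f u - f z) <= d by rewrite mulrBr; lra.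
  have [|fuz] := leP (f u : R) (f z); first by lra.
  suff : (f u : R) - f z <= k * ((f u : R) - f z) by lra.
  by rewrite ler_peMl// subr_ge0 ltW.
move: vz; rewrite /v'; case: eqP => [->|//] vz.
by rewrite normr0 !add0r; have := ler_normD u0 z; lra.
Qed.

(** Here [f z] must approximate [f y], which need not be near the maximum of
    [f].  Take [z1] near the maximum of [f] and then [z2] near its minimum,
    almost orthogonal to [v + z1]; the convex combination of [z1] and [z2] at
    which [f] takes the value [f y] is almost orthogonal to [v]. *)
Lemma daugavet_narrow_seminorm0 : narrow_seminorm (fun _ : X => 0).
Proof.
move=> f fB; apply: daugavet_seminorm_ball.
  apply: seminormD; last exact: seminorm_norm_linear.
  by split=> *; rewrite ?addr0 ?mulr0.
move=> v y e y1 e0.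
have [f0|/existsNP[u /eqP fu]] := pselect (forall u, f u = 0).
  have [->|v0] := eqVneq v 0.
    by exists y; rewrite f0 normr0 y1 add0r normr0 !add0r y1; split => //; lra.
  exists (`|v|^-1 *: v); rewrite f0 normr0 addr0 normrZ normfV normr_id.
  rewrite mulVf ?normr_eq0//; split => //.
  rewrite (_ : v + _ = (1 + `|v|^-1) *: v); last by rewrite scalerDl scale1r.
  rewrite normrZ ger0_norm ?addr_ge0//.
  by rewrite mulrDl mul1r mulVf ?normr_eq0//; lra.
pose d := e / 4.
have d0 : 0 < d by rewrite /d; lra.
have [z1 [z11 fz1 vz1]] := daugavet_slice v fB (ex_intro _ u fu) d0.
have [g gB gE] := @functional_combination _ _ unit (fun=> f) (fun=> -1) (fun=>
  fB).
have gN w : g w = - f w :> R.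
  by rewrite gE big_const cardT enumT unlock /= addr0 mulN1r.
have [|z2 [z21 gz2 vz2]] := daugavet_slice (v + z1) gB _ d0.
  by exists u; rewrite gN oppr_eq0.
have := fz1 y; have := gz2 y; rewrite y1 lexx !gN => /(_ isT) b /(_ isT) a.
have [l l0 [l1 fl]] : exists2 l : R, 0 <= l &
    l <= 1 /\ `|l * (f z1 - f y) + (1 - l) * (f z2 - f y)| <= d.
  have [h1|h1] := leP (f z1 - f y : R) d.
    exists 1; rewrite ?ler01// subrr mul0r addr0 mul1r ler_norml; split => //;
      lra.
  have [h2|h2] := leP (- d) (f z2 - f y : R).
    exists 0; rewrite ?ler01// subr0 mul0r add0r mul1r ler_norml; split => //;
      lra.
  have ab : 0 < (f z1 : R) - f z2 by lra.
  exists ((f y - f z2) / (f z1 - f z2)); first by rewrite divr_ge0//; lra.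
  split; first by rewrite ler_pdivrMr//; lra.
  rewrite [X in `|X|](_ : _ = 0) ?normr0; first exact: ltW.
  by field; exact: lt0r_neq0.
pose z := l *: z1 + (1 - l) *: z2.
have nl (w : X) : `|w| <= 1 -> forall c : R, 0 <= c -> `|c *: w| <= c.
  by move=> w1 c c0; rewrite normrZ ger0_norm// ler_piMr.
exists z; split.
- rewrite (le_trans (ler_normD _ _))//.
  have := nl _ z11 l l0; have := nl _ z21 (1 - l) ltac:(lra); lra.
- rewrite add0r /z linearB linearD.
  rewrite [X in `|X|](_ : _ = l * (f z1 - f y) + (1 - l) * (f z2 - f y)).
    by move: fl; rewrite /d; lra.
  by rewrite !functionalZ; ring.
have zE : v + z1 + z2 = (v + z) + ((1 - l) *: z1 + l *: z2).
  rewrite /z -[RHS]addrA addrACA -!scalerDl [l + _]addrC !subrK !scale1r.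
  by rewrite addrA.
have := ler_normD (v + z) ((1 - l) *: z1 + l *: z2); rewrite -zE.
have := ler_normD ((1 - l) *: z1) (l *: z2).
have := nl _ z11 (1 - l) ltac:(lra); have := nl _ z21 l l0.
by move: vz1 vz2; rewrite /d; lra.
Qed.

End DaugavetProperty.

(** * Maximal subsemigroups *)

Section CentralPart.
Variables (R : realType) (X : completeNormedModType R).

Lemma narrowP (Y : completeNormedModType R) (T : {linear X -> Y}) :
  narrow T <-> narrow_seminorm (op_class T).
Proof.
by split=> nT f fB; apply/(strong_daugavetP (tilde_sum T f)); exact: nT f fB.
Qed.

Lemma bounded_tilde_sum (Y1 Y2 : completeNormedModType R)
    (T1 : {linear X -> Y1}) (T2 : {linear X -> Y2}) :
  bounded_operator T1 -> bounded_operator T2 ->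
  bounded_operator (tilde_sum T1 T2).
Proof.
move=> [M1 TM1] [M2 TM2]; exists (M1 + M2) => u.
by rewrite sum1_normE/= mulrDl lerD.
Qed.

Section AddNotFixing.
Variables (Y : completeNormedModType R) (T : {linear X -> Y}).
Hypotheses (TB : bounded_operator T) (Tl1 : ~ fixes_copy_of_ell1 T).

Lemma NAR_add_not_fixing_ell1 (p : X -> R) : NAR X p -> NAR X (p + op_class T).
Proof.
move=> [Z [S [SB /narrowP nS ->]]]; exists (sum1 Z Y), (tilde_sum S T); split.
- exact: bounded_tilde_sum.
- apply/narrowP; apply: narrow_seminorm_not_fixing_ell1 => //.
  exact: seminorm_norm_linear.
- by rewrite op_class_tilde_sum.
Qed.

Lemma NAR0 : daugavet_property X -> NAR X 0.
Proof.
move=> XD.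
have op0 : op_class (\0 : {linear X -> Y}) = 0.
  by apply/funext => u; rewrite /op_class normr0.
exists Y, \0; rewrite op0; split => //; first by exists 0 => u;
  rewrite normr0 mul0r.
by apply/narrowP; rewrite op0; exact: daugavet_narrow_seminorm0.
Qed.

Lemma narrow_not_fixing_ell1 : daugavet_property X -> narrow T.
Proof.
move=> XD; apply/narrowP.
have := narrow_seminorm_not_fixing_ell1 _ (daugavet_narrow_seminorm0 XD) TB Tl1.
rewrite (_ : (fun u => 0 + _) = op_class T); first apply.
  by split=> *; rewrite ?addr0 ?mulr0.
by apply/funext => u; rewrite add0r.
Qed.

(** The subsemigroup generated by [M] and [T], together with the seminorm 0;
    letting [p0 = 0] puts the multiples of [T] themselves into it. *)
Definition adjoin (M : set (X -> R)) : set (X -> R) :=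
  [set p | exists p0 n, (M p0 \/ p0 = 0) /\ p = p0 + op_class T *+ n].

Lemma adjoin_sub_NAR M : daugavet_property X -> M `<=` NAR X ->
  adjoin M `<=` NAR X.
Proof.
move=> XD MN _ [p0 [n [p0M ->]]]; elim: n => [|n IHn].
  by rewrite mulr0n addr0; case: p0M => [/MN|->] //; exact: NAR0.
by rewrite mulrSr addrA; exact: NAR_add_not_fixing_ell1.
Qed.

Lemma adjoin_subsemigroup M : daugavet_property X -> M `<=` NAR X ->
  subsemigroup M -> subsemigroup (adjoin M).
Proof.
move=> XD MN [_ MD]; split.
  move=> p /(adjoin_sub_NAR XD MN)[Z [S [SB _ ->]]]; by exists Z, S.
move=> Y1 Y2 T1 T2 _ _ [p1 [n1 [Mp1 E1]]] [p2 [n2 [Mp2 E2]]].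
exists (p1 + p2), (n1 + n2)%N; split; last first.
  by rewrite op_class_tilde_sum E1 E2 mulrnDr addrACA.
case: Mp1 => [Mp1|->]; last by rewrite add0r.
case: Mp2 => [Mp2|->]; last by rewrite addr0; left.
have [Z1 [S1 [S1B _ pE1]]] := MN _ Mp1; have [Z2 [S2 [S2B _ pE2]]] := MN _ Mp2.
by left; rewrite pE1 pE2 -op_class_tilde_sum; apply: MD; rewrite -?pE1 -?pE2.
Qed.

End AddNotFixing.

End CentralPart.

Theorem theorem4p13 (R : realType) (X Y : completeNormedModType R)
    (T : {linear X -> Y}) :
  daugavet_property X ->
  bounded_operator T ->
  ~ fixes_copy_of_ell1 T ->
  central_part (NAR X) (op_class T) /\ narrow T.
Proof.
move=> XD TB Tl1; split; last exact: narrow_not_fixing_ell1.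
move=> M [Msub MN Mmax].
rewrite -(Mmax (adjoin T M)).
- by exists 0, 1%N; split; [right|rewrite add0r mulr1n].
- exact: adjoin_subsemigroup.
- exact: adjoin_sub_NAR.
- by move=> p Mp; exists p, 0%N; split; [left|rewrite mulr0n addr0].
Qed.
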